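(* Suppose a strongly regular graph $\Delta$ with parameters $(1276,50,0,2)$ exists, and let $x\in\operatorname{Aut}(\Delta)$ have odd prime order $p\neq 7$. Then one of the following holds: \begin{enumerate} \item[(1)] $p=3$, $\operatorname{Fix}(x)$ is the Clebsch graph, and $a_1(x)=0$; \item[(2)] $p=5$, and either $\operatorname{Fix}(x)\cong K_1$ and $a_1(x)=50$, or $\operatorname{Fix}(x)$ is the Clebsch graph and $a_1(x)=70$; \item[(3)] $p=11$, $\operatorname{Fix}(x)=\varnothing$, and $a_1(x)=44$; \item[(4)] $p=29$, $\operatorname{Fix}(x)=\varnothing$, and $a_1(x)=58$. \end{enumerate}
   Context: A strongly regular graph with parameters $(v,k,\lambda,\mu)$ is a finite simple $k$-regular graph on $v$ vertices in which any two adjacent vertices have exactly $\lambda$ common neighbours and any two distinct non-adjacent vertices have exactly $\mu$ common neighbours. For an automorphism $x$ of $\Delta$, $\operatorname{Fix}(x)$ is the subgraph induced on the vertices fixed by $x$ (with $\operatorname{Fix}(x)=\varnothing$ meaning that $x$ fixes no vertex), and $a_1(x)=|\{u\in V(\Delta):u\sim x(u)\}|$ is the number of vertices adjacent to their image under $x$. The Clebsch graph here means the folded $5$-cube, the unique (up to isomorphism) strongly regular graph with parameters $(16,5,0,2)$. $K_1$ is the one-vertex graph. *)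

(* Defs.v *)
From HB Require Import structures.
From mathcomp Require Import all_boot all_fingroup.

Set Implicit Arguments.
Unset Strict Implicit.
Unset Printing Implicit Defensive.

Record sgraph := SGraph {
  vertex :> finType;
  adj : rel vertex;
  adj_sym : symmetric adj;
  adj_irrefl : irreflexive adj }.

Arguments adj {s}.

Definition nbrs (G : sgraph) (u : G) : {set G} := [set w | adj u w].

Definition strongly_regular (G : sgraph) (v k l m : nat) : Prop :=
  [/\ #|G| = v,
      forall u : G, #|nbrs u| = k,
      forall u w : G, adj u w -> #|nbrs u :&: nbrs w| = l
    & forall u w : G, u != w -> ~~ adj u w -> #|nbrs u :&: nbrs w| = m].

Definition graph_iso (G H : sgraph) : Prop :=
  exists2 f : G -> H, bijective f & forall u w : G, adj (f u) (f w) = adj u w.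

Definition graph_aut (G : sgraph) : {set {perm G}} :=
  [set x : {perm G} | [forall u, forall w, adj (x u) (x w) == adj u w]].

Section Induced.

Variables (G : sgraph) (S : {set G}).

Definition induced_adj : rel {u : G | u \in S} := fun u w => adj (val u) (val w).

Lemma induced_adj_sym : symmetric induced_adj.
Proof. by move=> u w; exact: adj_sym. Qed.

Lemma induced_adj_irrefl : irreflexive induced_adj.
Proof. by move=> u; exact: adj_irrefl. Qed.

Definition induced : sgraph := SGraph induced_adj_sym induced_adj_irrefl.

End Induced.

Definition fix_graph (G : sgraph) (x : {perm G}) : sgraph := induced 'Fix_'P[x]%g.

Definition a1 (G : sgraph) (x : {perm G}) : nat := #|[set u : G | adj u (x u)]|.

Section Complete.

Variable n : nat.

Definition complete_adj : rel 'I_n := fun i j => i != j.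

Lemma complete_adj_sym : symmetric complete_adj.
Proof. by move=> i j; rewrite /complete_adj eq_sym. Qed.

Lemma complete_adj_irrefl : irreflexive complete_adj.
Proof. by move=> i; rewrite /complete_adj eqxx. Qed.

Definition complete_graph : sgraph := SGraph complete_adj_sym complete_adj_irrefl.

End Complete.

(* The 5-cube has the subsets of 'I_5 as vertices, two of them being adjacent
   when they differ in exactly one element; A and ~: A are antipodal.  The
   folded 5-cube is the quotient of the 5-cube by its antipodal map. *)
Definition cube_adj (A B : {set 'I_5}) : bool :=
  #|(A :\: B) :|: (B :\: A)| == 1.

Definition antipodal_pair (P : {set {set 'I_5}}) : bool :=
  [exists A, P == [set A; ~: A]].

Definition clebsch_adj : rel {P : {set {set 'I_5}} | antipodal_pair P} :=
  fun P Q => [exists A in val P, exists B in val Q, cube_adj A B].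

Lemma clebsch_adj_sym : symmetric clebsch_adj.
Proof.
move=> P Q; apply/idP/idP => /existsP[A /andP[PA /existsP[B /andP[QB AB]]]];
  apply/existsP; exists B; rewrite QB; apply/existsP; exists A;
  by rewrite PA /cube_adj setUC.
Qed.

Lemma clebsch_adj_irrefl : irreflexive clebsch_adj.
Proof.
move=> P; have /existsP[C /eqP PE] := valP P; apply/negbTE/existsP => -[A /andP[PA]].
case/existsP=> B /andP[PB]; rewrite /cube_adj.
have neqC (D : {set 'I_5}) : #|(D :\: ~: D) :|: (~: D :\: D)| != 1.
  by rewrite !setDE setCK !setIid setUCr cardsT card_ord.
move: PA PB; rewrite PE !inE => /orP[]/eqP-> /orP[]/eqP->;
  rewrite ?setDv ?setU0 ?cards0 //; apply/negP; first exact: neqC.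
by rewrite setUC neqC.
Qed.

Definition clebsch_graph : sgraph := SGraph clebsch_adj_sym clebsch_adj_irrefl.

(* Main.v *)
Require Import Defs.
From HB Require Import structures.
From mathcomp Require Import all_boot all_fingroup.
From mathcomp Require Import all_algebra all_solvable all_field.
From mathcomp Require Import ring zify.

(** Let A be the adjacency matrix of G, P the permutation matrix of x and
    F = Fix(x).  As p is odd, the two common neighbours of two non-adjacent
    fixed vertices are fixed, so that F again has no triangle and exactly two
    common neighbours for non-adjacent vertices.  Sending a vertex at distance
    two from a to the pair of its common neighbours with a is then a bijection
    onto the pairs of neighbours of a; hence F is regular, of some degree k, and
    |F| = 1 + k + k(k-1)/2 ([card_rectagraph]).

    A vertex outside F has at most one neighbour in F, and so
    |F|(50-k) <= 1276-|F|, which forces k <= 7 as F is not G ([fix_boundary]); x acts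
    semiregularly on the 50-k other neighbours of a fixed vertex, and so p
    divides 50-k; and for k > 1 the number k-1 must be a square, for otherwise
    the eigenvalues -1+s and -1-s of F with s^2 = k-1 would be conjugate and
    the trace of A(F) could not vanish ([integrality]).  This leaves k = 0
    (p = 5), k = 1 (p = 7), k = 2 (p = 3) and k = 5 (p = 3 or 5).  If F is
    empty, p divides 1276 = 4.11.29.

    What remains is to find a_1(x) = tr(PA) exactly.  Let M be a multiple of the
    projection onto an eigenspace of A, normalised to be an integral matrix
    aI+bA+cJ, say M^2 = dM.  For n = p^j, tr(PM^n) is the total weight of the
    walks u_0, ..., u_n with u_n = x(u_0).  Extended by u_(i+n) = x(u_i), these
    are permuted by the shift of indices, of order dividing p^(j+1); an orbit is
    either of full length p^(j+1) or made of walks fixed by the n-th power of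
    the shift, that is of walks inside F.  Hence
        d^(n-1) (a |F| + b a_1(x) + c |G|)  =  tr((M|F)^n)   mod p^(j+1)
    ([dvdz_twisted_trace], [fix_trace]).  The right-hand side is a sum of n-th
    powers of known integers, and e = f mod p implies e^n = f^n mod p^(j+1)
    ([dvdz_expr_sub]); letting j grow, the congruence becomes an equality which
    determines a_1(x) as soon as p does not divide d ([trace_unique]).  The
    projection onto the eigenspace of 6 has d = 308 = 4.7.11, the one for -8 has
    d = 406 = 2.7.29, so that the former serves for p = 3, 5 and 29 and the
    latter for p = 11.  For p = 3 there are no vertices adjacent to their image,
    as they would lie on triangles; the congruence then also excludes k = 2.
    Finally the bijection above with pairs shows that F is the folded 5-cube
    when k = 5 ([clebsch_unique]). *)

Set Implicit Arguments.
Unset Strict Implicit.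
Unset Printing Implicit Defensive.

Import GRing.Theory Num.Theory.

(** * Rectagraphs of diameter two and the folded 5-cube *)

(** Strongly regular graphs with parameters (v,k,0,2), with the regularity and
    the number of vertices left out: these follow ([card_rectagraph],
    [rectagraph_srg]), and fixed subgraphs inherit exactly this much. *)
Definition rectagraph (F : sgraph) :=
  (forall u w : F, adj u w -> #|nbrs u :&: nbrs w| = 0) /\
  (forall u w : F, u != w -> ~~ adj u w -> #|nbrs u :&: nbrs w| = 2).

Lemma srg_rectagraph (F : sgraph) v k :
  strongly_regular F v k 0 2 -> rectagraph F.
Proof. by case. Qed.

Section Pairs.

Variables (F : sgraph) (rectF : rectagraph F).
Implicit Types a u v w y z : F.

Lemma no_triangle u v w : adj u v -> adj u w -> ~~ adj v w.
Proof.
move=> uv uw; apply/negP => vw.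
move/eqP: (rectF.1 _ _ vw); rewrite cards_eq0 => /eqP/setP/(_ u).
by rewrite !inE !(adj_sym _ u) uv uw.
Qed.

Definition nonnbrs a := [set z | (z != a) && ~~ adj a z].

Definition foot a z := nbrs a :&: nbrs z.

Lemma card_foot a z : z \in nonnbrs a -> #|foot a z| = 2.
Proof. by rewrite inE eq_sym => /andP[za naz]; exact: rectF.2. Qed.

(** If z and z' had the same foot {y,y'}, then y and y' would have the three
    common neighbours a, z and z'. *)
Lemma foot_inj a : {in nonnbrs a &, injective (foot a)}.
Proof.
move=> z z' za z'a eq_foot; apply/eqP/negPn/negP => zz'.
have /cards2P[y [y' [yy' defS]]] : #|foot a z| == 2 by rewrite card_foot.
have: y \in foot a z by rewrite defS !inE eqxx.
have: y \in foot a z' by rewrite -eq_foot defS !inE eqxx.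
have: y' \in foot a z by rewrite defS !inE eqxx orbT.
have: y' \in foot a z' by rewrite -eq_foot defS !inE eqxx orbT.
rewrite !inE => /andP[ay' z'y'] /andP[_ zy'] /andP[ay z'y] /andP[_ zy].
have := rectF.2 _ _ yy' (no_triangle ay ay'); apply/eqP; rewrite neq_ltn.
apply/orP; right; apply: (@leq_trans #|[set a; z; z']|).
  move: za z'a; rewrite !inE => /andP[za _] /andP[z'a _].
  by rewrite -setUA cardsU1 cards2 zz' !inE negb_or (eq_sym a) za (eq_sym a) z'a.
apply: subset_leq_card; apply/subsetP => w; rewrite !inE -!(adj_sym w).
by case/orP => [/orP[]|] /eqP->; rewrite ?ay ?ay' ?zy ?zy' ?z'y ?z'y'.
Qed.

(** Two neighbours y and y' of a are not adjacent; besides a they have one more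
    common neighbour, and that is the vertex with foot {y,y'}. *)
Lemma foot_surj a y y' : adj a y -> adj a y' -> y != y' ->
  exists2 z, z \in nonnbrs a & foot a z = [set y; y'].
Proof.
move=> ay ay' yy'.
have card2 := rectF.2 _ _ yy' (no_triangle ay ay').
have : 0 < #|(nbrs y :&: nbrs y') :\ a|.
  by have := cardsD1 a (nbrs y :&: nbrs y'); rewrite card2 !inE -!(adj_sym a) ay ay' /=; lia.
case/card_gt0P => z; rewrite !inE => /and3P[za yz y'z].
have z2 : z \in nonnbrs a by rewrite inE za; apply: (@no_triangle y); rewrite // adj_sym.
exists z => //; apply/esym/eqP; rewrite eqEcard card_foot // cards2 yy' leqnn andbT.
by apply/subsetP => w; rewrite !inE => /orP[]/eqP->; rewrite ?ay ?ay' adj_sym.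
Qed.

Lemma imset_foot a :
  foot a @: nonnbrs a = [set B : {set F} | B \subset nbrs a & #|B| == 2].
Proof.
apply/setP => B; apply/imsetP/idP => [[z z2 ->]|].
  by rewrite inE card_foot // subsetIl.
rewrite inE => /andP[sBN /cards2P[y [y' [yy' defB]]]].
move: sBN; rewrite defB subUset !sub1set !inE => /andP[ay ay'].
by have [z] := foot_surj ay ay' yy'; exists z.
Qed.

Lemma card_rectagraph a : #|F| = 1 + #|nbrs a| + 'C(#|nbrs a|, 2).
Proof.
rewrite -cards_draws -imset_foot (card_in_imset (@foot_inj a)).
rewrite -(cardsC (a |: nbrs a)) cardsU1 inE adj_irrefl; congr (_ + #|pred_of_set _|).
by apply/setP => z; rewrite !inE negb_or.
Qed.

(** The count 1 + k + k(k-1)/2 of all the vertices, taken at a vertex of degree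
    k, determines k. *)
Lemma rectagraph_srg : 0 < #|F| -> exists k, strongly_regular F #|F| k 0 2.
Proof.
case/card_gt0P => a _; exists #|nbrs a|; split=> // [u||]; last 2 first.
- exact: rectF.1.
- exact: rectF.2.
have := card_rectagraph u; rewrite (card_rectagraph a) !bin2; nia.
Qed.

End Pairs.

Lemma srg_card (F : sgraph) v k :
  strongly_regular F v k 0 2 -> 0 < v -> v * 2 = k * k + k + 2.
Proof.
move=> srg v_gt0; have [cardF deg _ _] := srg.
have /card_gt0P[a _] : 0 < #|F| by rewrite cardF.
have := card_rectagraph (srg_rectagraph srg) a; rewrite cardF deg => ->.
have := bin_ffact k 2; rewrite ffactnS ffactn1 (_ : 2`! = 2) //; case: k {srg deg} => //=; nia.
Qed.

Section Clebsch.

Variables (F : sgraph) (srgF : strongly_regular F 16 5 0 2).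
Let rectF : rectagraph F := srg_rectagraph srgF.
Implicit Types a u v w y z : F.

(** Adjacent vertices have disjoint feet since there are no triangles.  For the
    converse, z has three neighbours not adjacent to a, their feet are pairs in
    the complement of the foot of z among the five neighbours of a, and this
    complement has just three pairs: every disjoint foot occurs. *)
Lemma adj_foot a z z' : z \in nonnbrs a -> z' \in nonnbrs a ->
  adj z z' = [disjoint foot a z & foot a z'].
Proof.
move=> za z'a; have [_ deg _ _] := srgF; apply/idP/idP => [zz'|dis].
  apply/pred0P => y; apply/negbTE/negP; rewrite /= !inE => /andP[/andP[_ zy] /andP[_ z'y]].
  by have := no_triangle rectF zz' zy; rewrite z'y.
pose D := nbrs z :\: nbrs a.
have sD2 : D \subset nonnbrs a.
  apply/subsetP => w; rewrite !inE => /andP[-> zw]; rewrite andbT.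
  by apply: contraTneq zw => ->; move: za; rewrite inE adj_sym => /andP[].
have cardD : #|D| = 3.
  have := cardsID (nbrs a) (nbrs z); rewrite deg setIC -/(foot a z) (card_foot rectF za).
  by rewrite -/D; lia.
have : foot a @: D = [set B : {set F} | B \subset nbrs a :\: foot a z & #|B| == 2].
  apply/eqP; rewrite eqEcard cards_draws card_in_imset; last first.
    by move=> w w' /(subsetP sD2) wa /(subsetP sD2) w'a; apply: (foot_inj rectF).
  have -> : #|nbrs a :\: foot a z| = 3.
    have := cardsID (foot a z) (nbrs a); rewrite deg /foot setIA setIid -/(foot a z).
    by rewrite (card_foot rectF za); lia.
  rewrite cardD leqnn andbT; apply/subsetP => _ /imsetP[w wD ->].
  rewrite inE (card_foot rectF) ?(subsetP sD2) // andbT; apply/subsetP => y.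
  move: wD; rewrite !inE => /andP[_ zw] /andP[-> wy]; rewrite andbT.
  by apply/negP => zy; have := no_triangle rectF zw zy; rewrite wy.
move/setP/(_ (foot a z')); rewrite [RHS]inE (card_foot rectF z'a) andbT.
have -> : foot a z' \subset nbrs a :\: foot a z.
  by rewrite subsetD subsetIl disjoint_sym.
case/imsetP => w wD /(foot_inj rectF z'a (subsetP sD2 _ wD)) ->.
by move: wD; rewrite !inE => /andP[].
Qed.

End Clebsch.

Definition symdiff (A B : {set 'I_5}) := (A :\: B) :|: (B :\: A).

Lemma card_symdiff A B : #|symdiff A B| + 2 * #|A :&: B| = #|A| + #|B|.
Proof.
rewrite -(cardsID B A) -(cardsID A B) (setIC B A) cardsU.
have -> : (A :\: B) :&: (B :\: A) = set0.
  by apply/setP => i; rewrite !inE; case: (i \in A); case: (i \in B).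
by rewrite cards0; lia.
Qed.

Lemma card_symdiffC A B : #|symdiff A (~: B)| = 5 - #|symdiff A B|.
Proof.
have -> : symdiff A (~: B) = ~: symdiff A B.
  by apply/setP => i; rewrite !inE; case: (i \in A); case: (i \in B).
by have := cardsC (symdiff A B); rewrite card_ord; lia.
Qed.

Lemma antipodal_pairP A : antipodal_pair [set A; ~: A].
Proof. by apply/existsP; exists A. Qed.

Definition clebsch_vertex A : clebsch_graph :=
  exist (fun P => antipodal_pair P) [set A; ~: A] (antipodal_pairP A).

(** Replacing one of two sets by its complement turns the size d of their
    symmetric difference into 5 - d. *)
Lemma clebsch_vertex_adj A B :
  adj (clebsch_vertex A) (clebsch_vertex B) =
  (#|symdiff A B| == 1) || (#|symdiff A B| == 4).
Proof.
rewrite /adj /= /clebsch_adj /=.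
have symC C : symdiff (~: C) =1 symdiff C \o @setC _.
  by move=> D; apply/setP => i; rewrite !inE; case: (i \in C); case: (i \in D).
have := card_symdiffC A B; have := card_symdiffC A (~: B); rewrite setCK => e1 e2.
apply/existsP/orP => [[A' /andP[]]|].
  rewrite !inE => Apair /existsP[B' /andP[]]; rewrite !inE /cube_adj => Bpair.
  rewrite -/(symdiff A' B').
  case/orP: Apair => /eqP->; case/orP: Bpair => /eqP->; rewrite ?symC /= ?setCK => /eqP e;
    by [left; rewrite e | right; rewrite e1 e | right; rewrite e1 e | left; rewrite e].
case=> /eqP e.
  exists A; rewrite !inE eqxx; apply/existsP; exists B.
  by rewrite !inE eqxx /cube_adj -/(symdiff A B) e.
exists A; rewrite !inE eqxx; apply/existsP; exists (~: B).
by rewrite !inE eqxx orbT /cube_adj -/(symdiff A (~: B)) e2 e.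
Qed.

(** Each antipodal pair has a member that avoids a given point. *)
Lemma card_clebsch : #|clebsch_graph| <= 16.
Proof.
rewrite card_sig.
have -> : 16 = #|powerset [set~ (ord0 : 'I_5)]|.
  by rewrite card_powerset cardsC1 card_ord.
apply: leq_trans (leq_imset_card (fun A => [set A; ~: A]) _).
apply: subset_leq_card; apply/subsetP => P /existsP[A /eqP ->].
have [A0|A0] := boolP (ord0 \in A); last first.
  by apply/imsetP; exists A => //; rewrite powersetE subsetC sub1set inE.
apply/imsetP; exists (~: A); last by rewrite setCK setUC.
by rewrite powersetE subsetC setCK sub1set.
Qed.

(** Number the neighbours of a vertex a by 'I_5 and label a by the empty set,
    its neighbours by singletons and the other vertices by their feet.  The
    labels are the ten pairs, five singletons and the empty set, one from each
    antipodal pair of subsets, and adjacency is a symmetric difference of size 1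
    or, for two disjoint pairs, of size 4 ([adj_foot]). *)
Theorem clebsch_unique (F : sgraph) :
  strongly_regular F 16 5 0 2 -> graph_iso F clebsch_graph.
Proof.
move=> srg; have [cardF deg _ _] := srg; have rect := srg_rectagraph srg.
have /card_gt0P[a _] : 0 < #|F| by rewrite cardF.
pose e (i : 'I_5) := enum_val (cast_ord (esym (deg a)) i).
have e_inj : injective e by move=> i j /enum_val_inj /cast_ord_inj.
have e_adj i : adj a (e i) by have := enum_valP (cast_ord (esym (deg a)) i); rewrite inE.
have e_surj y : adj a y -> exists i, y = e i.
  rewrite -[adj a y]in_set -/(nbrs a) => ay.
  exists (cast_ord (deg a) (enum_rank_in ay y)).
  by rewrite /e cast_ordK enum_rankK_in.
pose lab z : {set 'I_5} := [set i | (e i == z) || (adj (e i) z && (z != a))].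
have lab_a : lab a = set0.
  apply/setP => i; rewrite !inE eqxx andbF orbF; apply/negbTE.
  by apply: contraTneq (e_adj i) => ->; rewrite adj_irrefl.
have lab_e i : lab (e i) = [set i].
  apply/setP => j; rewrite !inE (inj_eq e_inj).
  by rewrite (negbTE (no_triangle rect (e_adj j) (e_adj i))) orbF.
have lab_z z : z \in nonnbrs a -> lab z = e @^-1: foot a z.
  rewrite inE => /andP[za naz]; apply/setP => i; rewrite !inE za andbT e_adj adj_sym /=.
  by case: eqP => //= ez; rewrite -ez e_adj in naz.
have imlab z : z \in nonnbrs a -> e @: lab z = foot a z.
  move=> za; rewrite (lab_z _ za); apply/setP => y; apply/imsetP/idP => [[i]|yz].
    by rewrite inE => ? ->.
  have [i yi] : exists i, y = e i by apply: e_surj; move: yz; rewrite !inE => /andP[].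
  by exists i; rewrite // inE -yi.
have card_lab z : z \in nonnbrs a -> #|lab z| = 2.
  by move=> za; rewrite -(card_imset _ e_inj) imlab // (card_foot rect).
have cases z : [\/ z = a, exists i, z = e i | z \in nonnbrs a].
  have [->|za] := eqVneq z a; first by constructor 1.
  have [/e_surj|naz] := boolP (adj a z); first by constructor 2.
  by constructor 3; rewrite inE za.
have lab_adj u w : adj u w =
    (#|symdiff (lab u) (lab w)| == 1) || (#|symdiff (lab u) (lab w)| == 4).
  (* Both sides are symmetric, so the labels may be taken in order of size. *)
  have sym (u' w' : F) : #|lab u'| <= #|lab w'| -> adj u' w' =
      (#|symdiff (lab u') (lab w')| == 1) || (#|symdiff (lab u') (lab w')| == 4).
    have := card_symdiff (lab u') (lab w').
    case: (cases u') => [->|[i ->]|u2]; case: (cases w') => [->|[j ->]|w2];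
      rewrite ?lab_a ?lab_e ?cards0 ?cards1 ?card_lab // ?card_lab //.
    - by rewrite set0I cards0 adj_irrefl; lia.
    - by rewrite set0I cards0 e_adj; lia.
    - by rewrite set0I cards0; move: w2; rewrite inE => /andP[_ /negbTE->]; lia.
    - have -> : adj (e i) (e j) = false by apply/negbTE/(no_triangle rect (e_adj i)).
      have : #|[set i] :&: [set j]| <= 1
        by rewrite -[X in _ <= X](cards1 i) subset_leq_card ?subsetIl.
      by move=> *; lia.
    - rewrite setIC lab_z //.
      have -> : #|(e @^-1: foot a w') :&: [set i]| = adj (e i) w'.
        have [iw|niw] := boolP (adj (e i) w').
          rewrite (_ : _ :&: _ = [set i]) ?cards1 //; apply/setIidPr.
          by rewrite sub1set !inE e_adj adj_sym.
        rewrite (_ : _ :&: _ = set0) ?cards0 //; apply/eqP; rewrite setI_eq0.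
        by rewrite disjoint_sym disjoints1 !inE e_adj adj_sym.
      by case: (adj (e i) w') => /=; lia.
    - rewrite (adj_foot srg u2 w2) -!imlab // -setI_eq0 -imsetI; last exact: in2W.
      rewrite imset_eq0 -cards_eq0.
      have := subset_leq_card (subsetIl (lab u') (lab w')); rewrite card_lab //.
      move: #|lab u' :&: lab w'| #|symdiff _ _| => m d *; lia.
  have symS A B : symdiff A B = symdiff B A by rewrite /symdiff setUC.
  by case: (leqP #|lab u| #|lab w|) => [|/ltnW] /sym //; rewrite adj_sym symS.
have lab_le2 z : #|lab z| <= 2.
  by case: (cases z) => [->|[i ->]|/card_lab->//]; rewrite ?lab_a ?lab_e ?cards0 ?cards1.
have lab_inj : injective lab.
  move=> u w eq_lab; case: (cases u) (cases w) eq_lab => [->|[i ->]|u2] [->|[j ->]|w2] //.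
  - by rewrite lab_a lab_e => /setP/(_ j); rewrite !inE eqxx.
  - by rewrite lab_a => eq_lab; have := card_lab _ w2; rewrite -eq_lab cards0.
  - by rewrite lab_a lab_e => /setP/(_ i); rewrite !inE eqxx.
  - by rewrite !lab_e => /set1_inj ->.
  - by rewrite lab_e => eq_lab; have := card_lab _ w2; rewrite -eq_lab cards1.
  - by rewrite lab_a => eq_lab; have := card_lab _ u2; rewrite eq_lab cards0.
  - by rewrite lab_e => eq_lab; have := card_lab _ u2; rewrite eq_lab cards1.
  - by move=> eq_lab; apply: (foot_inj rect u2 w2); rewrite -!imlab // eq_lab.
exists (fun z => clebsch_vertex (lab z)) => [|u w]; last first.
  by rewrite clebsch_vertex_adj lab_adj.
apply: inj_card_bij; last by rewrite cardF card_clebsch.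
move=> u w /(congr1 val) /= /setP/(_ (lab u)).
rewrite !inE eqxx => /esym/orP[/eqP/lab_inj // | /eqP eqC].
by have := cardsC (lab w); rewrite -eqC card_ord; have := lab_le2 u; have := lab_le2 w; lia.
Qed.

(** * The adjacency algebra *)

Section Algebra.
Local Open Scope ring_scope.

(** The entries of aI + bA + cJ, where J is the all-one matrix.  These matrices
    form an algebra, as A^2 = (k-2)I - 2A + 2J. *)
Definition lin (R : comNzRingType) (G : sgraph) (a b c : R) (u v : G) : R :=
  a * (u == v)%:R + b * (adj u v)%:R + c.

Lemma sum_indic (R : comNzRingType) (T : finType) (P : pred T) :
  \sum_w (P w)%:R = #|P|%:R :> R.
Proof. by rewrite -natr_sum -sum1_card [in RHS]big_mkcond; congr _%:R. Qed.

Lemma common_nbrs (R : comNzRingType) (G : sgraph) v k : strongly_regular G v k 0 2 ->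
  forall u w : G, \sum_z (adj u z)%:R * (adj z w)%:R =
                  (k%:R - 2) * (u == w)%:R - 2 * (adj u w)%:R + 2 :> R.
Proof.
move=> [_ degG tri quad] u w.
transitivity (#|nbrs u :&: nbrs w|%:R : R).
  under eq_bigr do rewrite -natrM mulnb.
  rewrite (sum_indic _ (fun z => adj u z && adj z w)); congr _%:R.
  by apply: eq_card => z; rewrite !inE (adj_sym w).
have [<-|neq] := eqVneq u w; first by rewrite setIid degG adj_irrefl mulr0 mulr1; ring.
case: (boolP (adj u w)) => [uw|nuw]; first by rewrite (tri _ _ uw) /=; ring.
by rewrite (quad _ _ neq nuw) /=; ring.
Qed.

Lemma lin_mul (R : comNzRingType) (G : sgraph) v k (a b c a' b' c' : R) :
    strongly_regular G v k 0 2 ->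
  forall u w : G, \sum_z lin a b c u z * lin a' b' c' z w =
  lin (a * a' + b * b' * (k%:R - 2)) (a * b' + b * a' - 2 * b * b')
      (a * c' + c * a' + 2 * b * b' + (b * c' + c * b') * k%:R + c * c' * v%:R) u w.
Proof.
move=> srg u w; have [cardG degG _ _] := srg.
have deg (z : G) : \sum_y (adj z y)%:R = k%:R :> R.
  by rewrite sum_indic -(degG z); congr _%:R; apply: eq_card => y; rewrite !inE.
have degl (z : G) : \sum_y (adj y z)%:R = k%:R :> R.
  by rewrite -(deg z); apply: eq_bigr => y _; rewrite adj_sym.
have eqsum (z : G) : \sum_y (y == z)%:R = 1 :> R.
  by rewrite (sum_indic _ (pred1 z)) card1.
have pick (f : G -> R) z : \sum_y (z == y)%:R * f y = f z.
  rewrite (bigD1 z) //= eqxx mul1r big1 ?addr0 // => y /negPf.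
  by rewrite eq_sym => ->; rewrite mul0r.
transitivity (a * (\sum_z (u == z)%:R * lin a' b' c' z w) +
   b * (\sum_z (adj u z)%:R * (a' * (z == w)%:R + b' * (adj z w)%:R + c')) +
   c * (\sum_z (a' * (z == w)%:R + b' * (adj z w)%:R + c'))).
  rewrite !mulr_sumr -!big_split; apply: eq_bigr => z _; rewrite /lin /=; ring.
rewrite pick.
have -> : \sum_z (a' * (z == w)%:R + b' * (adj z w)%:R + c') = a' + b' * k%:R + c' * v%:R.
  rewrite !big_split /= -!mulr_sumr eqsum degl sumr_const -cardG -[c' *+ _]mulr_natr; ring.
have -> : \sum_z (adj u z)%:R * (a' * (z == w)%:R + b' * (adj z w)%:R + c') =
   a' * (adj u w)%:R + b' * (\sum_z (adj u z)%:R * (adj z w)%:R) + k%:R * c'.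
  rewrite -(deg u) mulr_suml !mulr_sumr -(pick (fun z => a' * (adj u z)%:R) w).
  rewrite -!big_split; apply: eq_bigr => z _ /=; rewrite (eq_sym w); ring.
rewrite (common_nbrs _ srg) /lin; ring.
Qed.

(** The (u, v) entry of the power M^(n+1), with the intermediate vertices
    restricted to A: the exponent is shifted so that M^1 needs no identity
    matrix on A. *)
Fixpoint walks (T : finType) (A : {pred T}) (M : T -> T -> int) n u v : int :=
  if n is m.+1 then \sum_(w in A) M u w * walks A M m w v else M u v.

Lemma walks_idem (T : finType) (M : T -> T -> int) (c : int) :
    (forall u w, \sum_z M u z * M z w = c * M u w) ->
  forall n u w, walks predT M n u w = c ^+ n * M u w.
Proof.
move=> MM; elim=> [|n IH] u w /=; first by rewrite mul1r.
under eq_bigr do rewrite IH mulrCA.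
by rewrite -mulr_sumr MM exprS mulrA [c * _]mulrC.
Qed.

(** The matrix aI + bA + cJ has the eigenvalue a+bk+cv on the constants and
    a+b(s-1), a-b(s+1) on the eigenspaces of A for -1+s and -1-s.  The factors in
    front of the two latter powers are 2s times the dimensions of these spaces;
    multiplying by 2s keeps everything integral. *)
Lemma trace_walks (G : sgraph) v k s (a b c : int) n :
    strongly_regular G v k 0 2 -> k = (s * s).+1 -> (0 < v)%N ->
  2 * s%:R * (\sum_(u : G) walks predT (@lin int G a b c) n u u) =
  2 * s%:R * (a + b * k%:R + c * v%:R) ^+ n.+1
  + (v%:R * (1 + s%:R) - (k%:R + 1 + s%:R)) * (a + b * (s%:R - 1)) ^+ n.+1
  + (v%:R * (s%:R - 1) + (k%:R + 1 - s%:R)) * (a - b * (s%:R + 1)) ^+ n.+1.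
Proof.
move=> srg ks v_pos; have [cardG _ _ _] := srg.
have vk := srg_card srg v_pos.
have v_gt0 : v%:R != 0 :> int by rewrite pnatr_eq0 -lt0n.
set x0 := a + b * k%:R + c * v%:R; set x1 := a + b * (s%:R - 1).
set x2 := a - b * (s%:R + 1).
(* Spectral decomposition of the powers: the projections onto the eigenspaces
   of -1+s and -1-s are, up to the factors 2sv and -2sv, v(A+1+s) - (k+1+s)J
   and v(A+1-s) - (k+1-s)J. *)
have wE m u w : 2 * s%:R * v%:R * walks predT (@lin int G a b c) m u w =
  lin (v%:R * ((1 + s%:R) * x1 ^+ m.+1 - (1 - s%:R) * x2 ^+ m.+1))
      (v%:R * (x1 ^+ m.+1 - x2 ^+ m.+1))
      (2 * s%:R * x0 ^+ m.+1 - (k%:R + 1 + s%:R) * x1 ^+ m.+1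
        + (k%:R + 1 - s%:R) * x2 ^+ m.+1) u w.
  have ksR : k%:R = s%:R * s%:R + 1 :> int by rewrite ks -natr1 natrM.
  have vkR : v%:R * 2 = k%:R * k%:R + k%:R + 2 :> int.
    by rewrite -!natrM -!natrD vk.
  elim: m u w => [|m IH] u w /=.
    by rewrite !expr1 /lin /x0 /x1 /x2; ring.
  rewrite mulr_sumr; under eq_bigr do rewrite mulrCA IH.
  rewrite (lin_mul _ _ _ _ _ _ srg) /lin !(exprS _ m.+1).
  move: (x1 ^+ m.+1) (x2 ^+ m.+1) (x0 ^+ m.+1) => y1 y2 y0.
  have e : v%:R * 2 = (k%:R + 1) ^+ 2 - s%:R ^+ 2 :> int by rewrite vkR ksR; ring.
  congr (_ * _ + _ * _ + _); rewrite /x0 /x1 /x2 ?ksR; try ring.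
  apply/eqP; rewrite -subr_eq0; apply/eqP.
  transitivity (b * (y1 - y2) * (v%:R * 2 - ((k%:R + 1) ^+ 2 - s%:R ^+ 2))); last first.
    by rewrite e subrr mulr0.
  rewrite ksR; ring.
apply: (mulfI v_gt0); rewrite mulrA [X in X * _ = _]mulrC mulr_sumr.
under eq_bigr do rewrite wE.
rewrite (eq_bigr (fun=> v%:R * ((1 + s%:R) * x1 ^+ n.+1 - (1 - s%:R) * x2 ^+ n.+1)
   + (2 * s%:R * x0 ^+ n.+1 - (k%:R + 1 + s%:R) * x1 ^+ n.+1
        + (k%:R + 1 - s%:R) * x2 ^+ n.+1))) => [|u _]; last first.
  by rewrite /lin eqxx adj_irrefl /=; ring.
rewrite sumr_const cardG -[LHS]mulr_natl; ring.
Qed.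

Lemma idempotent_trace (F : fieldType) n (E : 'M[F]_n) :
  E *m E = E -> \tr E = (\rank E)%:R.
Proof.
move=> EE; have /row_freeP[R' R'1] := row_base_free E.
have /row_fullP[C' C'1] := col_base_full E.
have := mulmx_base E; move: (col_base E) (row_base E) R' C' R'1 C'1.
move: (\rank E) => r C R R' C' R'1 C'1 defE.
have RC : R *m C = 1%:M.
  have := congr1 (fun Z => C' *m Z *m R') EE; rewrite -defE.
  by rewrite !mulmxA C'1 !mul1mx -!mulmxA R'1 mulmx1.
by rewrite -defE mxtrace_mulC RC mxtrace1.
Qed.

(** For s^2 = k-1, the matrix (A+1 - (k+1)J/v + s(1-J/v))/2s is the projection
    onto an eigenspace of A, so its trace (v-k-1 + s(v-1))/2s is an integer and s
    is rational unless v = k+1. *)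
Lemma integrality (G : sgraph) v k : strongly_regular G v k 0 2 ->
  (1 < k < v)%N -> exists t, (k.-1 * t ^ 2 = (v - k.+1) ^ 2)%N.
Proof.
move=> srg /andP[k1 kv]; have [cardG _ _ _] := srg.
have vk := srg_card srg (leq_ltn_trans (leq0n k) kv).
pose s : algC := sqrtC k.-1%:R.
have ss : s ^+ 2 = k%:R - 1 by rewrite sqrtCK -subn1 natrB // ltnW.
have s0 : s != 0 by rewrite sqrtC_eq0 pnatr_eq0; lia.
have v0 : v%:R != 0 :> algC by rewrite pnatr_eq0; lia.
pose E : 'M[algC]_#|G| := \matrix_(i, j)
   lin ((1 + s) / (2 * s)) (1 / (2 * s)) (- (k%:R + 1 + s) / (2 * s * v%:R))
       (enum_val i) (enum_val j).
have EE : E *m E = E.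
  apply/matrixP => i j; rewrite !mxE.
  under eq_bigr do rewrite !mxE.
  rewrite -(reindex enum_val (P := predT)
    (F := fun z => lin _ _ _ _ z * lin _ _ _ z _)); last exact/onW_bij/enum_val_bij.
  rewrite (lin_mul _ _ _ _ _ _ srg).
  have vkR : v%:R * 2 = k%:R * k%:R + k%:R + 2 :> algC.
    by rewrite -!natrM -!natrD vk.
  have kE : k%:R = s ^+ 2 + 1 by rewrite ss subrK.
  have vE : v%:R = (k%:R * k%:R + k%:R + 2) / 2 :> algC by rewrite -vkR; field.
  congr lin.
  - by rewrite kE; field.
  - by field.
  - have := v0; rewrite vE kE => v0'; field; rewrite s0 /=.
    by move: v0'; rewrite mulf_eq0 negb_or => /andP[-> _].
have trE : (v%:R * (1 + s) - (k%:R + 1 + s)) / (2 * s) = (\rank E)%:R.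
  rewrite -(idempotent_trace EE) /mxtrace.
  under eq_bigr do rewrite mxE /lin eqxx adj_irrefl.
  rewrite sumr_const card_ord cardG -mulr_natl /=; field; by rewrite s0 v0.
pose t : int := 2 * (\rank E)%:R - v%:R + 1.
have st : t%:~R * s = (v - k.+1)%:R.
  rewrite /t rmorphD rmorphB rmorphM /= !rmorph_nat -trE natrB // -natr1; field; by [].
exists `|t|%N; apply/eqP; rewrite -(eqr_nat algC).
have tt : (`|t| ^ 2)%:R = t%:~R ^+ 2 :> algC.
  by rewrite -rmorphXn /= -[t ^+ 2]gez0_abs ?sqr_ge0 // -pmulrn abszX.
by rewrite natrM tt [X in _ == X]natrX -st exprMn ss mulrC -subn1 natrB ?(ltnW k1).
Qed.

End Algebra.

Lemma small_degree (G : sgraph) v k : strongly_regular G v k 0 2 ->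
  0 < v -> 1 < k <= 7 -> k \in [:: 2; 5].
Proof.
move=> srg v_gt0 /andP[k2 k7]; have vk := srg_card srg v_gt0.
have [|t sq] := integrality srg; first by rewrite k2 /=; nia.
(* As v-k-1 = k(k-1)/2, one factor k-1 cancels. *)
have {sq} sq : 4 * (t * t) = k * k * k.-1.
  case: k {srg k7} k2 sq vk => [|k] //= k_gt0 sq vk.
  have e : 2 * (v - k.+2) = k.+1 * k by lia.
  apply/eqP; rewrite -(eqn_pmul2l k_gt0); apply/eqP.
  transitivity (4 * (k * t ^ 2)); first by lia.
  rewrite sq; transitivity ((2 * (v - k.+2)) * (2 * (v - k.+2))); first by lia.
  by rewrite e; lia.
have t_le : t <= 8.
  rewrite leqNgt; apply/negP => t_gt.
  have : 9 * 9 <= t * t by rewrite leq_mul.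
  have : k * k * k.-1 <= 7 * 7 * 6 by rewrite !leq_mul // -subn1 leq_subLR.
  by lia.
have: all (fun k' => all (fun t' => (4 * (t' * t') == k' * k' * k'.-1) ==>
    (k' \in [:: 2; 5])) (iota 0 9)) (iota 2 6) by [].
move/allP/(_ k); rewrite mem_iota k2 ltnS k7 => /(_ isT)/allP/(_ t).
by rewrite mem_iota ltnS t_le sq eqxx; apply.
Qed.

(** * Congruences modulo powers of a prime *)

Section Congruences.
Local Open Scope ring_scope.

(** With y = a^(p^k) and z = b^(p^k), the factor y - z of y^p - z^p brings
    p^(k+1), and the cofactor is congruent to p z^(p-1) modulo p. *)
Lemma dvdz_expr_sub (p k : nat) (a b : int) : (p %| a - b)%Z ->
  ((p ^ k.+1)%N %| a ^+ (p ^ k) - b ^+ (p ^ k))%Z.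
Proof.
move=> pab; elim: k => [|k IH]; first by rewrite !expr1.
rewrite (expnSr p k.+1) [X in a ^+ X]expnSr [X in b ^+ X]expnSr !exprM.
move: (a ^+ _) (b ^+ _) IH => y z yz.
rewrite subrXX PoszM dvdz_mul //.
have pyz : (p %| y - z)%Z.
  by apply: dvdz_trans yz; rewrite expnS PoszM dvdz_mulr.
rewrite (eq_bigr (fun i : 'I_p => (y ^+ (p.-1 - i) - z ^+ (p.-1 - i)) * z ^+ i + z ^+ p.-1)).
  rewrite big_split sumr_const card_ord -mulr_natr natz.
  apply: rpredD; last by rewrite dvdz_mull.
  apply: rpred_sum => i _; rewrite subrXX -mulrA dvdz_mulr //.
move=> i _; rewrite mulrBl -exprD subnK ?subrK //.
by case: p i {yz pyz pab} => [|p] [].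
Qed.

Lemma dvdz_pow_eq0 (p : nat) (X : int) : (1 < p)%N ->
  (forall k, ((p ^ k.+1)%N %| X)%Z) -> X = 0.
Proof.
move=> p1 dvdX; apply/eqP; rewrite -absz_eq0 -leqn0 leqNgt; apply/negP => X0.
have := dvdn_leq X0 (dvdX `|X|%N); apply/negP; rewrite -ltnNge.
by apply: (ltn_trans (ltn_expl _ p1)); rewrite ltn_exp2l.
Qed.

(** An orbit of s has p^i elements with i <= k+1; when i <= k the permutation
    s^(p^k) is the identity on it, and when i = k+1 its p^(k+1) equal weights
    cancel modulo p^(k+1). *)
Lemma dvdz_orbit_sum (T : finType) (s : {perm T}) (w : T -> int) (p k : nat) :
    prime p -> (s ^+ (p ^ k.+1) = 1)%g -> (forall t, w (s t) = w t) ->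
  ((p ^ k.+1)%N %| \sum_t w t - \sum_(t | (s ^+ (p ^ k))%g t == t) w t)%Z.
Proof.
move=> p_pr s1 ws.
pose fixd t := (s ^+ (p ^ k))%g t == t.
rewrite (bigID fixd) /= addrAC subrr add0r.
rewrite (partition_big (porbit s) predT) //=; apply: rpred_sum => O _.
case: (pickP [pred t | ~~ fixd t & porbit s t == O]) => [t0 /=|none]; last first.
  by rewrite big_pred0 // dvdz0.
case/andP=> nfix /eqP defO.
have cardO : #|O| = (p ^ k.+1)%N.
  have : (#|O| %| p ^ k.+1)%N.
    rewrite -defO porbitE; apply: dvdn_trans (dvdn_orbit _ _ _) _.
    by rewrite -orderE order_dvdn s1.
  case/(dvdn_pfactor _ _ p_pr) => m lemk cardO; rewrite cardO.
  move: lemk; rewrite leq_eqVlt => /orP[/eqP-> // | ltmk].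
  case/negP: nfix; rewrite /fixd -(subnK (ltmk : m <= k)%N) addnC expnD -cardO -defO.
  have fix1 : (s ^+ #|porbit s t0|)%g t0 = t0 by rewrite permX iter_porbit.
  rewrite expgM permX; elim: (p ^ (k - m))%N => //= j IH.
  by rewrite (eqP IH) fix1.
have wO t : t \in O -> w t = w t0.
  rewrite -defO => /porbitP[i ->]; rewrite permX.
  by elim: i => //= i IH; rewrite ws.
have inO t : (~~ fixd t && (porbit s t == O)) = (t \in O).
  apply/andP/idP => [[_ /eqP <-]|tO]; first exact: porbit_id.
  have eqO : porbit s t = O by apply/eqP; rewrite -defO eq_porbit_mem defO.
  split; last exact/eqP.
  apply/negP => /eqP tfix; case/negP: nfix.
  move: tO; rewrite -defO porbit_sym => /porbitP[i ->].
  by rewrite /fixd -!permM -expgD addnC expgD permM tfix.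
rewrite (eq_bigl _ _ inO) (eq_bigr (fun=> w t0) wO) sumr_const cardO -mulr_natr.
by rewrite dvdz_mull // natz.
Qed.

Fixpoint path_weight (T : finType) (M : T -> T -> int) u (s : seq T) : int :=
  if s is v :: s' then M u v * path_weight M v s' else 1.

Lemma path_weight_rcons (T : finType) (M : T -> T -> int) u s v :
  path_weight M u (rcons s v) = path_weight M u s * M (last u s) v.
Proof. by elim: s u => [|w s IH] u /=; rewrite ?mulr1 ?mul1r // IH mulrA. Qed.

Lemma big_tupleS (T : finType) n (Q : pred (seq T)) (F : seq T -> int) :
  \sum_(s : n.+1.-tuple T | Q s) F s =
  \sum_u \sum_(t : n.-tuple T | Q (u :: t)) F (u :: t).
Proof.
rewrite pair_big_dep /= (reindex (fun ut : T * n.-tuple T => [tuple of ut.1 :: ut.2])) //=.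
exists (fun s : n.+1.-tuple T => (thead s, [tuple of behead s])) => [[u t] _|s _] /=.
  by congr pair; apply: val_inj.
by rewrite [RHS]tuple_eta.
Qed.

Lemma walks_tuple (T : finType) (A : {pred T}) (M : T -> T -> int) n u v :
  walks A M n u v = \sum_(t : n.-tuple T | all (mem A) t) path_weight M u (rcons t v).
Proof.
elim: n u => [|n IH] u /=.
  rewrite (big_pred1 [tuple]) /= ?mulr1 // => t; rewrite (tuple0 t) /=.
  by apply/esym/eqP.
rewrite (big_tupleS _ (all (mem A)) (fun s => path_weight M u (rcons s v))) /= big_mkcond.
apply: eq_bigr => w _; case: (w \in A) => /=; last by rewrite big_pred0.
by rewrite IH big_distrr.
Qed.

Lemma walks_sub (T : finType) (A : {pred T}) (M : T -> T -> int) n (u v : {w | w \in A}) :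
  walks predT (fun w z => M (val w) (val z)) n u v = walks A M n (val u) (val v).
Proof.
elim: n u => [|n IH] u //=.
rewrite [RHS]big_sub.
by apply: eq_bigr => w _; rewrite IH.
Qed.

Section Shift.
Variables (T : finType) (x : {perm T}) (M : T -> T -> int) (n : nat).
Hypothesis Mx : forall u v, M (x u) (x v) = M u v.

(* A tuple stands for a walk s_0, ..., s_n, x(s_0), and hence for the sequence
   indexed by all integers with s_(i+n+1) = x(s_i). *)
Let twist (s : n.+1.-tuple T) : n.+1.-tuple T :=
  [tuple of rcons (behead s) (x (thead s))].

Lemma twist_inj : injective twist.
Proof.
move=> s t; case/tupleP: s => u s; case/tupleP: t => v t /(congr1 val) /= eq_st.
have /rcons_inj[] : rcons s (x u) = rcons t (x v) by exact: eq_st.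
by move=> eqs /perm_inj ->; apply: val_inj; rewrite /= eqs.
Qed.

Definition shift : {perm n.+1.-tuple T} := perm twist_inj.

Lemma val_shiftX (s : n.+1.-tuple T) j : (j <= n.+1)%N ->
  val ((shift ^+ j)%g s) = drop j s ++ map x (take j s).
Proof.
elim: j => [|j IH] ltjn; first by rewrite drop0 take0 cats0 perm1.
rewrite expgSr permM permE /twist /=.
have := IH (ltnW ltjn); set r := (fun_of_perm _ s); case/tupleP: r => u r /=.
have z0 : T by exact: u.
rewrite theadE (drop_nth z0) ?size_tuple // => -[-> ->] /=.
by rewrite (take_nth z0) ?size_tuple // map_rcons rcons_cat.
Qed.

Lemma val_shift_pow (s : n.+1.-tuple T) m :
  val ((shift ^+ (n.+1 * m))%g s) = map (x ^+ m)%g s.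
Proof.
elim: m => [|m IH]; first by rewrite muln0 perm1 (eq_map (@perm1 T)) map_id.
rewrite mulnS addnC expgD permM val_shiftX // IH.
rewrite drop_oversize ?size_map ?size_tuple // take_oversize ?size_map ?size_tuple //=.
by rewrite -map_comp; apply: eq_map => u; rewrite /= expgSr permM.
Qed.

Definition closed_weight (s : seq T) : int :=
  if s is u :: t then path_weight M u (rcons t (x u)) else 1.

Lemma closed_weight_shift (s : n.+1.-tuple T) :
  closed_weight (shift s) = closed_weight s.
Proof.
rewrite permE /twist; case/tupleP: s => u s /=; rewrite theadE /=.
case: s => -[|v s] ss /=; first by rewrite Mx.
by rewrite path_weight_rcons last_rcons Mx mulrC.
Qed.

Lemma closed_weight_sum (A : {pred T}) :
  \sum_(s : n.+1.-tuple T | all (mem A) s) closed_weight s =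
  \sum_(u in A) walks A M n u (x u).
Proof.
rewrite (big_tupleS _ (all (mem A)) closed_weight) [RHS]big_mkcond.
apply: eq_bigr => u _ /=; case: (u \in A) => /=; last by rewrite big_pred0.
by rewrite walks_tuple.
Qed.

End Shift.

(** In matrix terms, tr(PM^n) and the trace of (M|Fix)^n agree modulo p^(k+1) for
    n = p^k.  The shift of twisted closed walks has an order dividing p^(k+1), and
    its n-th power is x, so that the walks it fixes are those inside Fix. *)
Theorem dvdz_twisted_trace (T : finType) (x : {perm T}) (M : T -> T -> int) p k :
    prime p -> (x ^+ p = 1)%g -> (forall u v, M (x u) (x v) = M u v) ->
  ((p ^ k.+1)%N %|
     \sum_u walks predT M (p ^ k).-1 u (x u) -
     \sum_(u in 'Fix_'P[x]%g) walks 'Fix_'P[x]%g M (p ^ k).-1 u u)%Z.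
Proof.
move=> p_pr x1 Mx; set n := (p ^ k).-1.
(* [walks] with index n is the power n+1 = p^k *)
have pk : (p ^ k)%N = n.+1 by rewrite prednK // expn_gt0 prime_gt0.
pose s := shift x n.
have s1 : (s ^+ (p ^ k.+1) = 1)%g.
  apply/permP => t; apply: val_inj; rewrite expnSr pk val_shift_pow x1 perm1.
  by rewrite (eq_map (@perm1 T)) map_id.
have := dvdz_orbit_sum p_pr s1 (closed_weight_shift Mx).
rewrite -(eq_bigl _ _ (fun t : n.+1.-tuple T => all_predT t)) closed_weight_sum.
rewrite (eq_bigl (fun t : n.+1.-tuple T => all (mem 'Fix_'P[x]%g) t)) => [|t]; last first.
  have -> : (p ^ k = n.+1 * 1)%N by rewrite muln1.
  rewrite -val_eqE val_shift_pow expg1.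
  case: t => t /= _; elim: t => //= u r IH; rewrite eqseq_cons IH; congr andb.
  exact/eqP/afix1P.
rewrite closed_weight_sum; congr (_ %| _ - _)%Z.
by apply: eq_bigr => u; by move/afix1P; rewrite /= /aperm => ->.
Qed.

End Congruences.

(** * Automorphisms of odd prime order *)

Lemma card_induced (G : sgraph) (S A : {set G}) :
  #|[set u : induced S | val u \in A]| = #|A :&: S|.
Proof.
rewrite -(card_imset _ val_inj); congr #|pred_of_set _|; apply/setP => u.
apply/imsetP/idP => [[w]|]; first by rewrite !inE => wA ->; rewrite wA; exact: valP.
by rewrite inE => /andP[uA uS]; exists (exist _ u uS); rewrite ?inE.
Qed.

Lemma sum_lin (G : sgraph) (x : {perm G}) (a b c : int) :
  (\sum_u lin a b c u (x u) = a * #|'Fix_'P[x]%g|%:R + b * (a1 x)%:R + c * #|G|%:R)%R.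
Proof.
rewrite !big_split /= -!mulr_sumr sumr_const -[(c *+ _)%R]mulr_natr; congr (_ * _ + _ * _ + _)%R.
  rewrite (sum_indic _ (fun u => u == x u)); congr _%:R%R; apply: eq_card => u.
  by rewrite unfold_in eq_sym; apply/eqP/afix1P.
rewrite (sum_indic _ (fun u => adj u (x u))); congr _%:R%R; apply: eq_card => u.
by rewrite inE.
Qed.

Section Automorphism.

Variables (G : sgraph) (v k : nat) (srgG : strongly_regular G v k 0 2).
Variables (x : {perm G}) (x_aut : x \in graph_aut G).
Variables (p : nat) (p_pr : prime p) (p_odd : odd p) (ord_x : #[x]%g = p).

Let rectG : rectagraph G := srg_rectagraph srgG.
Notation Fix := ('Fix_'P[x]%g).

Lemma adj_aut u w : adj (x u) (x w) = adj u w.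
Proof. by move: x_aut; rewrite inE => /forallP/(_ u)/forallP/(_ w)/eqP. Qed.

Lemma card_stable (A : {set G}) :
  (forall u, u \in A -> x u \in A) -> #|A| = #|A :&: Fix| %[mod p].
Proof.
move=> stA; have x_pgroup : (p.-group <[x]>)%g by rewrite /pgroup -orderE ord_x pnat_id.
rewrite -afix_cycle ?inE //; apply: (pgroup_fix_mod x_pgroup).
rewrite cycle_subG !inE /=; apply/subsetP => u uA.
by rewrite inE /= /aperm stA.
Qed.

Lemma card_fix : v = #|Fix| %[mod p].
Proof.
have [<- _ _ _] := srgG; rewrite -cardsT -[Fix]setTI.
by apply: card_stable.
Qed.

Lemma fix_nbrs u : u \in Fix -> {in nbrs u, forall w, x w \in nbrs u}.
Proof. by move/afix1P=> /= xu w; rewrite !inE -{2}xu /aperm adj_aut. Qed.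

Lemma card_fix_nbrs u : u \in Fix -> k = #|nbrs u :&: Fix| %[mod p].
Proof.
by move=> ufix; have [_ deg _ _] := srgG; rewrite -(deg u); apply/card_stable/fix_nbrs.
Qed.

(** The number of fixed points among the two common neighbours is 2 modulo p, and
    p > 2. *)
Lemma fix_common u w : u \in Fix -> w \in Fix -> u != w -> ~~ adj u w ->
  nbrs u :&: nbrs w \subset Fix.
Proof.
move=> ufix wfix uw nuw; apply/setIidPl.
apply/eqP; rewrite eqEcard subsetIl (rectG.2 _ _ uw nuw).
have := card_stable (A := nbrs u :&: nbrs w).
rewrite (rectG.2 _ _ uw nuw) => modp.
have p3 : 2 < p by rewrite odd_gt2 // prime_gt1.
have := subset_leq_card (subsetIl (nbrs u :&: nbrs w) Fix).
rewrite (rectG.2 _ _ uw nuw) => le2; move: modp.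
rewrite !modn_small ?(leq_ltn_trans le2) // => <- // z.
by rewrite !in_setI => /andP[zu zw]; rewrite !fix_nbrs.
Qed.

Lemma nbrs_fix_graph (u w : fix_graph x) :
  #|nbrs u :&: nbrs w| = #|nbrs (val u) :&: nbrs (val w) :&: Fix|.
Proof. by rewrite -[RHS]card_induced; apply: eq_card => z; rewrite !inE. Qed.

Lemma fix_rectagraph : rectagraph (fix_graph x).
Proof.
split=> u w; rewrite nbrs_fix_graph.
  by move=> uw; rewrite (cards0_eq (rectG.1 _ _ uw)) set0I cards0.
move=> uw nuw; rewrite (setIidPl (fix_common (valP u) (valP w) uw nuw)).
exact: rectG.2.
Qed.

Lemma card_fix_graph : #|fix_graph x| = #|Fix|.
Proof. by rewrite card_sig; apply: eq_card. Qed.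

(** Two fixed neighbours of z would have z as a common neighbour. *)
Lemma fix_attached z : z \notin Fix -> #|nbrs z :&: Fix| <= 1.
Proof.
move=> znfix; apply/card_le1_eqP => u w.
rewrite !in_setI ![_ \in nbrs z]in_set => /andP[zu ufix] /andP[zw wfix].
apply/eqP/negPn/negP; rewrite eq_sym => uw.
have nuw := no_triangle rectG zu zw.
case/negP: znfix; apply: (subsetP (fix_common ufix wfix uw nuw)).
by rewrite in_setI !in_set -!(adj_sym z) zu zw.
Qed.

(** Counts the edges between Fix and its complement. *)
Lemma fix_boundary k' : strongly_regular (fix_graph x) #|Fix| k' 0 2 ->
  #|Fix| * (k - k') <= v - #|Fix|.
Proof.
move=> [_ degF _ _]; have [cardG degG _ _] := srgG.
have bdry u : u \in Fix -> \sum_(z in ~: Fix) (adj u z : nat) = k - k'.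
  move=> ufix; rewrite -(degG u) -(degF (exist _ u ufix)).
  have -> : nbrs (exist _ u ufix : fix_graph x) =
     [set z : induced Fix | val z \in nbrs u] by apply/setP => z; rewrite !inE.
  rewrite card_induced -cardsD -sum1_card big_mkcond [in RHS]big_mkcond /=.
  by apply: eq_bigr => z _; rewrite in_setC in_setD [_ \in nbrs u]in_set;
    case: (z \in Fix); case: (adj u z).
rewrite -sum_nat_const -(eq_bigr _ bdry) exchange_big /=.
have -> : v - #|Fix| = #|~: Fix| by rewrite [RHS]cardsCs setCK cardG.
rewrite -sum1_card leq_sum // => z; rewrite in_setC => /fix_attached.
apply: leq_trans; rewrite -sum1_card big_mkcond [leqRHS]big_mkcond /=.
apply: leq_sum => u _; rewrite in_setI [_ \in nbrs z]in_set adj_sym.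
by case: (u \in Fix); case: (adj z u).
Qed.

Lemma fix_proper : #|Fix| < v.
Proof.
have [<- _ _ _] := srgG; rewrite ltn_neqAle max_card andbT.
apply: contraTN p_pr => /eqP fixG; rewrite -ord_x; suff -> : x = 1%g by rewrite order1.
have /setP allfix : Fix = [set: G].
  by apply/eqP; rewrite eqEcard subsetT cardsT fixG leqnn.
by apply/permP => u; rewrite perm1; have /afix1P := allfix u; rewrite in_setT; apply.
Qed.

(** A vertex u adjacent to x u lies on the triangle u, x u, x^2 u. *)
Lemma a1_order3 : p = 3 -> a1 x = 0.
Proof.
move=> p3; apply/eqP; rewrite cards_eq0; apply/eqP/setP => u; rewrite !inE.
apply/negbTE/negP => ux.
have x3 : x (x (x u)) = u.
  by rewrite -[LHS]/(iter 3 x u) -permX -p3 -ord_x expg_order perm1.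
have uxx : adj u (x (x u)) by rewrite adj_sym -{2}x3 !adj_aut.
by have := no_triangle rectG ux uxx; rewrite adj_aut ux.
Qed.

(** The three equations say that M = aI + bA + cJ satisfies M^2 = dM, whence
    tr(PM^n) = d^(n-1) tr(PM). *)
Lemma fix_trace (a b c d : int) j :
    (a * a + b * b * (k%:R - 2) = d * a)%R ->
    (a * b + b * a - 2 * b * b = d * b)%R ->
    (a * c + c * a + 2 * b * b + (b * c + c * b) * k%:R + c * c * v%:R = d * c)%R ->
  ((p ^ j.+1)%N %| (d ^+ (p ^ j).-1 * (a * #|Fix|%:R + b * (a1 x)%:R + c * v%:R)
    - \sum_(u : fix_graph x) walks predT (lin a b c) (p ^ j).-1 u u)%R)%Z.
Proof.
move=> ea eb ec; have [cardG _ _ _] := srgG.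
have MM (u w : G) : (\sum_z lin a b c u z * lin a b c z w = d * lin a b c u w)%R.
  by rewrite (lin_mul _ _ _ _ _ _ srgG) ea eb ec /lin; ring.
have linx (u w : G) : lin a b c (x u) (x w) = lin a b c u w.
  by rewrite /lin adj_aut (inj_eq perm_inj).
have := dvdz_twisted_trace j p_pr _ linx; rewrite -{1}ord_x expg_order => /(_ erefl).
under eq_bigr do rewrite (walks_idem MM).
rewrite -mulr_sumr sum_lin cardG (big_sub Fix).
congr (is_true ((_ - _)%R \in dvdz _)); apply: eq_bigr => u _; rewrite -walks_sub.
by [].
Qed.

(** The difference X - dt is divisible by every power of p. *)
Lemma trace_unique (d X t : int) (T : nat -> int) : coprimez p d ->
    (forall j, ((p ^ j.+1)%N %| (d ^+ (p ^ j).-1 * X - T j)%R)%Z) ->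
    (forall j, ((p ^ j.+1)%N %| (T j - d ^+ (p ^ j) * t)%R)%Z) ->
  X = (d * t)%R.
Proof.
move=> cop TX Tt; apply/eqP; rewrite -subr_eq0; apply/eqP.
apply: (@dvdz_pow_eq0 p) => [|j]; first exact: prime_gt1.
rewrite -(@Gauss_dvdzr _ (d ^+ (p ^ j).-1)%R); last first.
  by rewrite coprimezE abszX coprimeXl // coprimeXr.
have := rpredD (TX j) (Tt j); congr (is_true (_ \in dvdz _)).
have -> : (d ^+ (p ^ j) = d ^+ (p ^ j).-1 * d)%R.
  by rewrite -exprSr prednK // expn_gt0 prime_gt0.
ring.
Qed.

End Automorphism.

(** * Automorphisms of a graph with parameters (1276,50,0,2) *)

Lemma trace_fix0 (G : sgraph) (x : {perm G}) M n :
  'Fix_'P[x]%g = set0 -> (\sum_(u : fix_graph x) walks predT M n u u = 0)%R.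
Proof.
move=> fix0; apply: big1 => u _; have /setP/(_ (val u)) := fix0.
by rewrite in_set0 (valP u).
Qed.

Lemma trace_K1 (F : sgraph) (a b c : int) n : #|F| = 1 ->
  (\sum_(u : F) walks predT (lin a b c) n u u = (a + c) ^+ n.+1)%R.
Proof.
move/fintype1=> [o all_o].
have linE (u w : F) : lin a b c u w = (a + c)%R.
  by rewrite /lin (all_o u) (all_o w) eqxx adj_irrefl /=; ring.
have only (f : F -> int) : (\sum_u f u = f o)%R.
  by rewrite (big_pred1 o) // => u; rewrite (all_o u) /= eqxx.
by rewrite only (@walks_idem _ _ (a + c)%R) => [|u w]; rewrite ?only !linE // exprSr.
Qed.

Lemma iso_K1 (F : sgraph) : #|F| = 1 -> graph_iso F (complete_graph 1).
Proof.
move=> F1; exists (fun=> ord0) => [|u w].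
  apply: inj_card_bij; last by rewrite card_ord F1.
  by move=> u w _; have [o all_o] := fintype1 F1; rewrite (all_o u) (all_o w).
by have [o all_o] := fintype1 F1; rewrite (all_o u) (all_o w) !adj_irrefl.
Qed.

Section Graph1276.

Variables (G : sgraph) (srgG : strongly_regular G 1276 50 0 2).
Variables (x : {perm G}) (x_aut : x \in graph_aut G).
Variables (p : nat) (p_pr : prime p) (p_odd : odd p) (ord_x : #[x]%g = p).
Notation Fix := ('Fix_'P[x]%g).

(* 176I + 22A - J and 174I - 29A + J are 308 and 406 times the projections onto
   the eigenspaces of A for 6 and -8; 308 = (6+8)(50-6)/2 and
   406 = (6+8)(50+8)/2. *)
Let T6 j := (\sum_(u : fix_graph x) walks predT (lin 176 22 (-1)) (p ^ j).-1 u u)%R.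
Let T8 j := (\sum_(u : fix_graph x) walks predT (lin 174 (-29) 1) (p ^ j).-1 u u)%R.

Lemma trace6 j : ((p ^ j.+1)%N %|
  (308 ^+ (p ^ j).-1 * (176 * #|Fix|%:R + 22 * (a1 x)%:R - 1276) - T6 j)%R)%Z.
Proof.
rewrite -[(- 1276)%R]mulN1r; apply: (fix_trace srgG x_aut p_pr ord_x); lia.
Qed.

Lemma trace8 j : ((p ^ j.+1)%N %|
  (406 ^+ (p ^ j).-1 * (174 * #|Fix|%:R - 29 * (a1 x)%:R + 1276) - T8 j)%R)%Z.
Proof.
rewrite -mulNr -[1276%R]mul1r; apply: (fix_trace srgG x_aut p_pr ord_x); lia.
Qed.

(** The first projection serves for p = 29 and the second for p = 11, as 11
    divides 308 and 29 divides 406. *)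
Lemma fix_empty : Fix = set0 -> (p = 11 /\ a1 x = 44) \/ (p = 29 /\ a1 x = 58).
Proof.
move=> fix0.
have : p \in primes 1276.
  have := card_fix srgG p_pr ord_x; rewrite fix0 cards0 mem_primes p_pr /= mod0n.
  by move/eqP.
rewrite (_ : primes 1276 = [:: 2; 11; 29]) // !inE.
case/or3P => /eqP p_eq.
- by move: p_odd; rewrite p_eq.
- left; split=> //.
  have e : (174 * #|Fix|%:R - 29 * (a1 x)%:R + 1276 = 406 * 0 :> int)%R.
    apply: (trace_unique p_pr _ trace8) => [|j]; first by rewrite p_eq.
    by rewrite /T8 trace_fix0 // mulr0 subrr dvdz0.
  by move: e; rewrite fix0 cards0; lia.
- right; split=> //.
  have e : (176 * #|Fix|%:R + 22 * (a1 x)%:R - 1276 = 308 * 0 :> int)%R.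
    apply: (trace_unique p_pr _ trace6) => [|j]; first by rewrite p_eq.
    by rewrite /T6 trace_fix0 // mulr0 subrr dvdz0.
  by move: e; rewrite fix0 cards0; lia.
Qed.

Lemma trace6_srg (k s : nat) : k = (s * s).+1 ->
  strongly_regular (fix_graph x) #|Fix| k 0 2 -> (0 < #|Fix|)%N -> forall j,
  (2 * s%:R * T6 j = 2 * s%:R * (176 + 22 * k%:R - #|Fix|%:R) ^+ (p ^ j)
   + (#|Fix|%:R * (1 + s%:R) - (k%:R + 1 + s%:R)) * (176 + 22 * (s%:R - 1)) ^+ (p ^ j)
   + (#|Fix|%:R * (s%:R - 1) + (k%:R + 1 - s%:R)) * (176 - 22 * (s%:R + 1)) ^+ (p ^ j))%R.
Proof.
move=> ks srgF f0 j; rewrite /T6 (trace_walks _ _ _ _ srgF ks f0) mulN1r.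
by rewrite prednK // expn_gt0 prime_gt0.
Qed.

Lemma dvdz_expr_pow (e : int) j : (p %| e)%Z -> ((p ^ j.+1)%N %| (e ^+ (p ^ j))%R)%Z.
Proof.
move=> pe; have := @dvdz_expr_sub p j e 0; rewrite subr0 => /(_ pe).
by rewrite expr0n expn_eq0 -[p == 0]negbK -lt0n prime_gt0 // subr0.
Qed.

(** The matrix is reduced to the single entry 176 - 1 on Fix, and 5 divides 175:
    the trace on Fix tends to 0 in the 5-adic integers. *)
Lemma fix_K1 : p = 5 -> #|Fix| = 1 -> a1 x = 50.
Proof.
move=> p5 f1.
have e : (176 * #|Fix|%:R + 22 * (a1 x)%:R - 1276 = 308 * 0 :> int)%R.
  apply: (trace_unique p_pr _ trace6) => [|j]; first by rewrite p5.
  rewrite /T6 trace_K1 ?card_fix_graph // mulr0 subr0.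
  by rewrite prednK ?expn_gt0 ?prime_gt0 //; apply: dvdz_expr_pow; rewrite p5.
by move: e; rewrite f1; lia.
Qed.

(** On the Clebsch graph, which has the eigenvalues 5, 1 (ten times) and -3 (five
    times), the matrix has the eigenvalues 270, 198 and 110.  Modulo 5, the
    first and the last vanish and 198 = 308; so a_1(x) is as if the matrix had
    the trace 10 * 308 on Fix. *)
Lemma fix_clebsch : p = 5 -> #|Fix| = 16 ->
  strongly_regular (fix_graph x) #|Fix| 5 0 2 -> a1 x = 70.
Proof.
move=> p5 f16 srgF.
have f0 : (0 < #|Fix|)%N by rewrite f16.
have T := trace6_srg (erefl : 5 = (2 * 2).+1) srgF f0.
have e : (4 * (176 * #|Fix|%:R + 22 * (a1 x)%:R - 1276) = 308 * 40 :> int)%R.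
  apply: (@trace_unique p p_pr _ _ _ (fun j => 4 * T6 j)%R) => [|j|j].
  - by rewrite p5.
  - have := dvdz_mull 4 (trace6 j); congr (is_true (_ \in dvdz _)); ring.
  have -> : (4 * T6 j - 308 ^+ (p ^ j) * 40 = 4 * 270 ^+ (p ^ j) +
       20 * 110 ^+ (p ^ j) + 40 * (198 ^+ (p ^ j) - 308 ^+ (p ^ j)))%R.
    transitivity (2 * 2%:R * T6 j - 308 ^+ (p ^ j) * 40)%R; first by ring.
    rewrite T f16.
    have -> : (176 + 22 * 5 - 16 = 270 :> int)%R by lia.
    have -> : (176 + 22 * (2 - 1) = 198 :> int)%R by lia.
    have -> : (176 - 22 * (2 + 1) = 110 :> int)%R by lia.
    ring.
  apply: rpredD; first apply: rpredD.
  - by apply/dvdz_mull/dvdz_expr_pow; rewrite p5.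
  - by apply/dvdz_mull/dvdz_expr_pow; rewrite p5.
  - by apply/dvdz_mull/dvdz_expr_sub; rewrite p5.
by move: e; rewrite f16; lia.
Qed.

(** On the 4-cycle the eigenvalues 216, 176 (twice) and 132 are 0, 308 and 0 modulo
    3, which would give 22 a_1(x) = 1188 against [a1_order3]. *)
Lemma fix_square : p = 3 -> #|Fix| = 4 ->
  ~ strongly_regular (fix_graph x) #|Fix| 2 0 2.
Proof.
move=> p3 f4 srgF.
have f0 : (0 < #|Fix|)%N by rewrite f4.
have T := trace6_srg (erefl : 2 = (1 * 1).+1) srgF f0.
have e : (2 * (176 * #|Fix|%:R + 22 * (a1 x)%:R - 1276) = 308 * 4 :> int)%R.
  apply: (@trace_unique p p_pr _ _ _ (fun j => 2 * T6 j)%R) => [|j|j].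
  - by rewrite p3.
  - have := dvdz_mull 2 (trace6 j); congr (is_true (_ \in dvdz _)); ring.
  have -> : (2 * T6 j - 308 ^+ (p ^ j) * 4 = 2 * 216 ^+ (p ^ j) +
       2 * 132 ^+ (p ^ j) + 4 * (176 ^+ (p ^ j) - 308 ^+ (p ^ j)))%R.
    transitivity (2 * 1%:R * T6 j - 308 ^+ (p ^ j) * 4)%R; first by ring.
    rewrite T f4.
    have -> : (176 + 22 * 2 - 4 = 216 :> int)%R by lia.
    have -> : (176 + 22 * (1 - 1) = 176 :> int)%R by lia.
    have -> : (176 - 22 * (1 + 1) = 132 :> int)%R by lia.
    ring.
  apply: rpredD; first apply: rpredD.
  - by apply/dvdz_mull/dvdz_expr_pow; rewrite p3.
  - by apply/dvdz_mull/dvdz_expr_pow; rewrite p3.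
  - by apply/dvdz_mull/dvdz_expr_sub; rewrite p3.
by move: e; rewrite f4 (a1_order3 srgG x_aut ord_x p3); lia.
Qed.

Lemma fix_degree : (0 < #|Fix|)%N -> exists k,
  [/\ strongly_regular (fix_graph x) #|Fix| k 0 2, (k <= 7)%N & p %| 50 - k].
Proof.
move=> f0; have [|k srgF] := rectagraph_srg (fix_rectagraph srgG x_aut p_pr p_odd ord_x).
  by rewrite card_fix_graph.
rewrite card_fix_graph in srgF; have k7 : (k <= 7)%N.
  have := fix_boundary srgG x_aut p_pr p_odd ord_x srgF.
  have := fix_proper srgG p_pr ord_x; have := srg_card srgF f0.
  move: #|Fix| => f fk fv bd; rewrite leqNgt; apply/negP => k7.
  have k50 : (k < 50)%N by nia.
  have : (f * 2 * (51 - k) <= 2552)%N by nia.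
  rewrite fk.
  (* for 7 < k < 50 the cubic (k^2+k+2)(51-k) exceeds 2552 = 2 * 1276 *)
  have [k17|k17] := leqP k 16; first by nia.
  by have [k43|k43] := leqP k 42; nia.
exists k; split=> //.
have [u ufix] := card_gt0P f0.
have := card_fix_nbrs srgG x_aut p_pr ord_x ufix.
have [_ /(_ (exist _ u ufix)) deg _ _] := srgF.
have <- : k = #|nbrs u :&: Fix|.
  by rewrite -deg -card_induced; apply: eq_card => z; rewrite !inE.
by move/eqP; rewrite eqn_mod_dvd // (leq_trans k7).
Qed.

End Graph1276.

Theorem proposition8p6 (G : sgraph) (hG : strongly_regular G 1276 50 0 2)
    (x : {perm G}) (hx : x \in graph_aut G)
    (p : nat) (hp : prime p) (hodd : odd p) (hp7 : p <> 7) (hord : #[x]%g = p) :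
  [\/ [/\ p = 3, graph_iso (fix_graph x) clebsch_graph & a1 x = 0],
      p = 5 /\
        ((graph_iso (fix_graph x) (complete_graph 1) /\ a1 x = 50) \/
         (graph_iso (fix_graph x) clebsch_graph /\ a1 x = 70)),
      [/\ p = 11, 'Fix_'P[x]%g = set0 & a1 x = 44]
    | [/\ p = 29, 'Fix_'P[x]%g = set0 & a1 x = 58] ].
Proof.
have [fix0|] := eqVneq ('Fix_'P[x]%g) set0.
  have [[p11 a1E]|[p29 a1E]] := fix_empty hG hx hp hodd hord fix0.
    by constructor 3.
  by constructor 4.
rewrite -card_gt0 => f0.
have [k [srgF k7 pk]] := fix_degree hG hx hp hodd hord f0.
have fk := srg_card srgF f0.
have p_in m q : p %| m.+1 -> primes m.+1 = q -> p \in q.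
  by move=> pm <-; rewrite mem_primes hp pm.
have [k2|k2] := leqP k 1; last first.
  have : k \in [:: 2; 5] by apply: (small_degree srgF f0); rewrite k2.
  rewrite !inE => /orP[]/eqP k_eq.
    have : p \in [:: 2; 3] by rewrite k_eq in pk; apply: p_in pk _; vm_compute.
    rewrite !inE => /orP[]/eqP p3; first by rewrite p3 in hodd.
    case: (@fix_square _ hG x hx p hp hodd hord p3).
      by move: fk; rewrite k_eq; lia.
    by rewrite k_eq in srgF.
  have f16 : #|'Fix_'P[x]%g| = 16 by move: fk; rewrite k_eq; lia.
  have iso : graph_iso (fix_graph x) clebsch_graph.
    by apply: clebsch_unique; rewrite k_eq f16 in srgF.
  have : p \in [:: 3; 5] by rewrite k_eq in pk; apply: p_in pk _; vm_compute.
  rewrite !inE => /orP[]/eqP p_eq.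
    by constructor 1; split=> //; exact: (a1_order3 hG hx hord p_eq).
  constructor 2; split=> //; right; split=> //.
  by apply: (fix_clebsch hG hx hp hodd hord p_eq f16); rewrite k_eq in srgF.
have k0 : k = 0.
  case: k k2 pk {k7 srgF fk} => [|[|k]] // _ pk.
  have : p \in [:: 7] by apply: p_in pk _; vm_compute.
  by rewrite inE => /eqP.
have f1 : #|'Fix_'P[x]%g| = 1 by move: fk; rewrite k0; lia.
have : p \in [:: 2; 5] by rewrite k0 in pk; apply: p_in pk _; vm_compute.
rewrite !inE => /orP[]/eqP p_eq; first by rewrite p_eq in hodd.
constructor 2; split=> //; left; split; first by apply: iso_K1; rewrite card_fix_graph.
exact: (fix_K1 hG hx hp hodd hord).
Qed.
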